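(* Let $$E_n(x)=\frac{a_0}{2}+\sum_{l=1}^{n}\bigl(a_l\cosh lx+b_l\sinh lx\bigr)$$ be an exponential polynomial with real coefficients in which at least one of the leading coefficients $a_n$, $b_n$ is not zero, and suppose that $E_n$ has distinct real roots $x_1,\ldots,x_m$, $m\ge 2$, with multiplicities $\alpha_1,\ldots,\alpha_m$ respectively, $\alpha_1+\ldots+\alpha_m=2n$. Put $d=\min_{i\neq j}|x_i-x_j|$. Let $q$ and $c$ be real numbers such that $1>q>0$, $c>0$, $d-2c>0$ and $$c^2\bigl(4n+(S^2-2)\alpha_i\bigr)<S^2\alpha_i,\qquad i=1,\ldots,m,$$ where $S=\sinh\left(\frac{d-2c}{2}\right)$. Let the sequences $x_i^{[k]}$, $i=1,\ldots,m$, $k=0,1,2,\ldots$, be generated from initial approximations $x_1^{[0]},\ldots,x_m^{[0]}$ by $$x_i^{[k+1]}=x_i^{[k]}-\alpha_i E_n\bigl(x_i^{[k]}\bigr)\left[E_n'\bigl(x_i^{[k]}\bigr)-E_n\bigl(x_i^{[k]}\bigr)\frac{Q_i'\bigl(x_i^{[k]}\bigr)}{Q_i\bigl(x_i^{[k]}\bigr)}\right]^{-1},\qquad i=1,\ldots,m,\ k=0,1,2,\ldots,$$ where, at step $k$, $Q_i(x)=\prod_{j\neq i,\,j=1}^{m}\sinh^{\alpha_j}\left(\frac{x-x_j^{[k]}}{2}\right)$. If the initial approximations satisfy $|x_i^{[0]}-x_i|\le cq$ for $i=1,\ldots,m$, then for every $k\in\mathbb{N}$ the inequalities $$|x_i^{[k]}-x_i|\le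 c\,q^{3^k},\qquad i=1,\ldots,m,$$ hold.
   Context: The iteration is a method for simultaneously approximating all roots of $E_n$ when their multiplicities $\alpha_i$ (positive integers) are known. The function $Q_i$ depends on the iteration number $k$ through the current approximations $x_j^{[k]}$, and $Q_i'$ denotes its derivative with respect to $x$. *)

(* Defs.v *)
From HB Require Import structures.
From mathcomp Require Export all_boot all_order all_algebra.
From mathcomp Require Export all_classical all_reals all_analysis.

Set Implicit Arguments.
Unset Strict Implicit.
Unset Printing Implicit Defensive.

Import Order.TTheory GRing.Theory Num.Theory.
Import numFieldNormedType.Exports.

Local Open Scope classical_set_scope.
Local Open Scope ring_scope.

Definition sinh (R : realType) (x : R) : R := (expR x - expR (- x)) / 2.
Definition cosh (R : realType) (x : R) : R := (expR x + expR (- x)) / 2.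

(* The value [b 0] is unused. *)
Definition exp_poly (R : realType) (n : nat) (a b : nat -> R) (x : R) : R :=
  a 0%N / 2 +
  \sum_(1 <= l < n.+1) (a l * cosh (l%:R * x) + b l * sinh (l%:R * x)).

(* In [classical_set_scope], [f^`(k)] is the analytic k-th derivative. *)
Definition root_of_multiplicity (R : realType) (f : R -> R) (x : R) (k : nat)
  : Prop :=
  [/\ (0 < k)%N,
      forall l : nat, (l < k)%N -> (f^`(l))%classic x = 0
    & (f^`(k))%classic x <> 0].

Definition is_min_dist (R : realType) (m : nat) (x : 'I_m -> R) (d : R) : Prop :=
  (exists i j : 'I_m, i <> j /\ d = `|x i - x j|) /\
  (forall i j : 'I_m, i <> j -> d <= `|x i - x j|).

(* [y] is the vector of current approximations. *)
Definition Qfun (R : realType) (m : nat) (alpha : 'I_m -> nat) (y : 'I_m -> R)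
    (i : 'I_m) (x : R) : R :=
  \prod_(j < m | j != i) sinh ((x - y j) / 2) ^+ alpha j.

(* Main.v *)
(** Put [p(X)] for the polynomial of degree at most [2n] with
    [E_n(x) = e^(-nx) p(e^x)].  Differentiating [e^(-nx) p(e^x)] replaces [p] by
    [X p' - n p], so a root [r_i] of multiplicity [alpha_i] makes
    [(X - e^(r_i))^alpha_i] divide [p]; as the multiplicities sum to [2n],
    [E_n] is a nonzero multiple of [prod_j sinh^alpha_j ((x - r_j) / 2)].

    Let [y_j] be the current approximations, [e = y_i - r_i], and
    [t = tanh (e / 2)].  Comparing logarithmic derivatives, the new error is
    [e - 2 t / (1 + t B)] with
    [B = sum_(j != i) (alpha_j / alpha_i) (coth u_j - coth v_j)],
    [u_j = (y_i - r_j) / 2], [v_j = (y_i - y_j) / 2], and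
    [coth u_j - coth v_j = sinh (v_j - u_j) / (sinh u_j sinh v_j)] is of the
    order of [y_j - r_j].  If all current errors are at most [delta <= c], the
    hypothesis on [c] forces [c < 1] and
    [|B| <= delta (1 - c^2) / (2 c^2)]; with [|e - 2 t| <= |e|^3 / 2] the new
    error is at most [delta^3 / c^2], and
    [(c q^(3^k))^3 / c^2 = c q^(3^(k+1))]. *)

Require Import Defs.
From mathcomp Require Import all_boot all_order all_algebra.
From mathcomp Require Import all_classical all_reals all_analysis.
From mathcomp Require Import ring lra zify.

Import Order.TTheory GRing.Theory Num.Theory.
Import numFieldNormedType.Exports.

Local Open Scope ring_scope.

Set Implicit Arguments.
Unset Strict Implicit.
Unset Printing Implicit Defensive.

Lemma sinh0 (R : realType) : sinh (0 : R) = 0.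
Proof. by rewrite /sinh oppr0 subrr mul0r. Qed.

Lemma sinhN (R : realType) (z : R) : sinh (- z) = - sinh z.
Proof. by rewrite /sinh opprK -mulNr opprB. Qed.

Lemma coshN (R : realType) (z : R) : cosh (- z) = cosh z.
Proof. by rewrite /cosh opprK addrC. Qed.

Lemma sinhB (R : realType) (u v : R) :
  sinh (u - v) = sinh u * cosh v - cosh u * sinh v.
Proof. by rewrite /sinh /cosh opprB !expRD; field. Qed.

Lemma cosh_double (R : realType) (z : R) : cosh (z + z) = 1 + 2 * sinh z ^+ 2.
Proof.
have E : expR z * expR (- z) = 1 by rewrite -expRD subrr expR0.
rewrite /cosh /sinh opprD !expRD.
transitivity (expR z * expR (- z) + 2 * ((expR z - expR (- z)) / 2) ^+ 2).
  by field.
by rewrite E.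
Qed.

Lemma ler_sinh (R : realType) (u v : R) : u <= v -> sinh u <= sinh v.
Proof.
move=> uv; rewrite /sinh ler_pM2r; last by lra.
by apply: lerB; rewrite ler_expR // lerN2.
Qed.

Lemma ltr_sinh (R : realType) (u v : R) : u < v -> sinh u < sinh v.
Proof.
move=> uv; rewrite /sinh ltr_pM2r; last by lra.
by apply: ltrB; rewrite ltr_expR // ltrN2.
Qed.

Lemma sinh_gt0 (R : realType) (z : R) : 0 < z -> 0 < sinh z.
Proof. by rewrite -[X in _ -> X < _]sinh0; exact: ltr_sinh. Qed.

Lemma sinh_eq0 (R : realType) (z : R) : (sinh z == 0) = (z == 0).
Proof.
apply/eqP/eqP => [|->]; last exact: sinh0.
case: (ltrgtP z 0) => // z0 s0.
- by have := ltr_sinh z0; rewrite s0 sinh0 ltxx.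
- by have := ltr_sinh z0; rewrite s0 sinh0 ltxx.
Qed.

Lemma normr_sinh (R : realType) (z : R) : `|sinh z| = sinh `|z|.
Proof.
case: (lerP 0 z) => z0.
- by rewrite !ger0_norm // -[leLHS]sinh0 ler_sinh.
- rewrite (ltr0_norm z0) ltr0_norm ?sinhN // -[ltRHS]sinh0.
  exact: ltr_sinh.
Qed.

Lemma cosh_ge1 (R : realType) (z : R) : 1 <= cosh z.
Proof. by have := expR_ge1Dx z; have := expR_ge1Dx (- z); rewrite /cosh; lra. Qed.

Lemma ler_cosh (R : realType) (u v : R) : 0 <= u -> u <= v -> cosh u <= cosh v.
Proof.
move=> u0 uv; rewrite /cosh ler_pM2r; last by lra.
have a0 := expR_gt0 u; have b0 := expR_gt0 v.
have a1 : 1 <= expR u by rewrite -expR0 ler_expR.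
have ab : expR u <= expR v by rewrite ler_expR.
have ha : expR u * expR (- u) = 1 by rewrite -expRD subrr expR0.
have hb : expR v * expR (- v) = 1 by rewrite -expRD subrr expR0.
have c1 : expR (- u) <= 1 by rewrite -expR0 ler_expR oppr_le0.
have e1 : expR (- v) <= 1 by rewrite -expR0 ler_expR oppr_le0; lra.
have c0 := expR_gt0 (- u); have e0 := expR_gt0 (- v).
(* This product expands to [2 * (cosh v - cosh u)], since [expR u] and [expR (- u)] are inverse to
   each other, and likewise for [v]. *)
have : 0 <= (expR v - expR u) * (1 - expR (- u) * expR (- v)).
  by apply: mulr_ge0; rewrite subr_ge0 // mulr_ile1 // ltW.
have -> : (expR v - expR u) * (1 - expR (- u) * expR (- v)) =
  expR v - expR u - (expR v * expR (- v)) * expR (- u)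
  + (expR u * expR (- u)) * expR (- v) by ring.
rewrite ha hb; lra.
Qed.

Lemma is_derive_sinh (R : realType) (z : R) :
  is_derive z 1 (@sinh R) (cosh z).
Proof.
have h1 : is_derive z 1 (fun x : R => expR (- x)) (- expR (- z)).
  rewrite -mulrN1.
  exact: is_derive1_comp (is_derive_expR _) (is_deriveNid z 1).
have h2 := is_deriveM (is_deriveB (is_derive_expR z) h1)
  (is_derive_cst (2^-1 : R) z 1).
have -> : @sinh R = (expR - (fun x => expR (- x))) * cst 2^-1 by [].
apply: (is_derive_eq h2).
by rewrite scaler0 add0r opprK /cosh mulrC.
Qed.

Lemma sinh_mean_value (R : realType) (z : R) : 0 <= z ->
  exists2 w, 0 <= w <= z & sinh z = cosh w * z.
Proof.
rewrite le_eqVlt => /predU1P[<-|z0].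
  by exists 0; rewrite ?lexx ?sinh0 ?mulr0.
have [||w] := @MVT R (@sinh R) (@cosh R) _ _ z0.
- by move=> x _; exact: is_derive_sinh.
- apply: continuous_subspaceT => x.
  apply: differentiable_continuous; apply/derivable1_diffP.
  by have [] := is_derive_sinh x.
rewrite in_itv /= => /andP[w0 wz]; rewrite sinh0 !subr0 => ->.
by exists w; rewrite ?(ltW w0) ?(ltW wz).
Qed.

Lemma sinh_ge_id (R : realType) (z : R) : 0 <= z -> z <= sinh z.
Proof.
move=> z0; have [w _ ->] := sinh_mean_value z0.
exact: ler_peMl z0 (cosh_ge1 w).
Qed.

Lemma sinh_le_cosh (R : realType) (z : R) : 0 <= z -> sinh z <= z * cosh z.
Proof.
move=> z0; have [w /andP[w0 wz] ->] := sinh_mean_value z0.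
by rewrite mulrC ler_wpM2l // ler_cosh.
Qed.

(** From [expR (- z) >= 1 - z >= 1 / 2] one gets [expR z <= 2], while [expR (- z) <= 1]. *)
Lemma cosh_le2 (R : realType) (z : R) : 0 <= z <= 1 / 2 -> cosh z <= 2.
Proof.
move=> /andP[z0 z1].
have E : expR z * expR (- z) = 1 by rewrite -expRD subrr expR0.
have e1 := expR_ge1Dx (- z); have e2 := expR_gt0 z.
have e3 : expR (- z) <= 1 by rewrite -expR0 ler_expR oppr_le0.
rewrite /cosh; nra.
Qed.

Lemma sinh_le2 (R : realType) (z : R) : 0 <= z <= 1 / 2 -> sinh z <= 2 * z.
Proof.
move=> /[dup] /andP[z0 _] /cosh_le2 z2.
apply: le_trans (sinh_le_cosh z0) _.
by rewrite mulrC ler_wpM2r.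
Qed.

(** Doubling gives [cosh z = 1 + 2 * sinh (z / 2) ^+ 2], and [sinh (z / 2) <= z] on this range. *)
Lemma cosh_le_quadratic (R : realType) (z : R) :
  0 <= z <= 1 / 2 -> cosh z <= 1 + 2 * z ^+ 2.
Proof.
move=> /andP[z0 z1].
have := cosh_double (z / 2); rewrite -splitr => ->.
rewrite lerD2l ler_pM2l //.
have s0 : 0 <= sinh (z / 2) by apply: le_trans (sinh_ge_id _); lra.
have h : sinh (z / 2) <= 2 * (z / 2) by apply: sinh_le2; lra.
by rewrite ler_sqr ?nnegrE //; lra.
Qed.

Lemma normr_tanh_le (R : realType) (z : R) : `|sinh z / cosh z| <= `|z|.
Proof.
have c1 := cosh_ge1 z.
rewrite normf_div normr_sinh [`|cosh z|]ger0_norm; last by lra.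
rewrite ler_pdivrMr; last by lra.
have -> : cosh z = cosh `|z| by case: ler0P => // _; rewrite coshN.
exact: sinh_le_cosh.
Qed.

(** By oddness take [z >= 0]. Over the denominator [cosh z >= 1] the numerator is
    [z * cosh z - sinh z <= z * (cosh z - 1)], which the quadratic bound on [cosh] makes at most
    [2 * z ^+ 3]. *)
Lemma sub_tanh_le (R : realType) (z : R) : `|z| <= 1 / 2 ->
  `|z - sinh z / cosh z| <= 2 * `|z| ^+ 3.
Proof.
wlog z0 : z / 0 <= z => [H z1|z1].
  have [|/ltW z0] := lerP 0 z; first by move/H; exact.
  have := H (- z); rewrite sinhN coshN normrN mulNr -opprD normrN; apply=> //.
  by rewrite oppr_ge0.
have c1 := cosh_ge1 z.
have s1 := sinh_ge_id z0; have s2 := sinh_le_cosh z0.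
move: z1; rewrite [`|z|]ger0_norm // => z1.
have c2 : cosh z <= 1 + 2 * z ^+ 2 by apply: cosh_le_quadratic; rewrite z0.
have -> : z - sinh z / cosh z = (z * cosh z - sinh z) / cosh z by field; lra.
rewrite normf_div [`|cosh z|]ger0_norm; last by lra.
rewrite ger0_norm ?subr_ge0 // ler_pdivrMr; last by lra.
have z3 : 0 <= z ^+ 3 by exact: exprn_ge0.
have : z * cosh z <= z * (1 + 2 * z ^+ 2) by rewrite ler_wpM2l.
have -> : z * (1 + 2 * z ^+ 2) = z + 2 * z ^+ 3 by ring.
nra.
Qed.

(** * Factorization of the exponential polynomial through its roots *)

(** The Euler operator [X d/dX] minus [n]: it is d/dx transported to [p] through [expR (- (n%:R *
    x)) * p.[expR x]]. *)
Definition shifted_euler (R : nzRingType) (n : nat) (p : {poly R}) : {poly R} :=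
  'X * p^`() - n%:R *: p.

(** Induction on [k] for all [p] at once: the hypothesis for [k] applies to both [p] and its image,
    so the k-th power divides [p] and ['X * p^]()[. As]z !=
    0[, it is coprime to]'X[and divides]p^[()]; in characteristic zero this forces one more factor
    in [p]. *)
Lemma dvdp_XsubC_exp_shifted_euler (R : numFieldType) (n k : nat)
    (p : {poly R}) (z : R) : z != 0 ->
  (forall l, (l < k)%N -> (iter l (shifted_euler n) p).[z] = 0) ->
  ('X - z%:P) ^+ k %| p.
Proof.
move=> z0; elim: k p => [|k IH] p Hp; first by rewrite expr0 dvd1p.
have dp : ('X - z%:P) ^+ k %| p by apply: IH => l lk; apply: Hp; exact: ltnW.
have dDp : ('X - z%:P) ^+ k %| shifted_euler n p.
  by apply: IH => l lk; rewrite -iterSr; exact: Hp.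
have dp' : ('X - z%:P) ^+ k %| p^`().
  have: ('X - z%:P) ^+ k %| 'X * p^`().
    by rewrite -[X in _ %| X](subrK (n%:R *: p)) dvdp_add // -mul_polyC dvdp_mull.
  rewrite Gauss_dvdpr // coprimep_expl //.
  by rewrite coprimep_sym coprimep_XsubC rootX.
(* With exponent zero the derivative carries no information, so the first factor comes directly from
   [p.[z] = 0]. *)
case: k dp dp' {IH dDp} Hp => [|k] dp dp' Hp.
  by rewrite expr1 dvdp_XsubCl; apply/rootP; exact: (Hp 0%N).
case/dvdpP: dp => g gE; move: dp'.
rewrite gE derivM dvdp_addr; last by rewrite dvdp_mull.
rewrite deriv_exp derivXsubC mul1r mulrnAr -scaler_nat dvdpZr ?pnatr_eq0 //=.
have nz : ('X - z%:P) ^+ k != 0 by rewrite expf_neq0 // polyXsubC_eq0.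
rewrite exprS dvdp_mul2r // => zg.
by rewrite 2!exprS dvdp_mul.
Qed.

(** [X^n * E_n] written in [X = e^x]. The truncated subtraction [n - l] is exact because
    [l <= n]. *)
Definition exp_poly_numerator (R : realType) (n : nat) (a b : nat -> R) :
    {poly R} :=
  (a 0%N / 2) *: 'X^n + \sum_(1 <= l < n.+1)
    (((a l + b l) / 2) *: 'X^(n + l) + ((a l - b l) / 2) *: 'X^(n - l)).

Lemma size_exp_poly_numerator (R : realType) (n : nat) (a b : nat -> R) :
  (size (exp_poly_numerator n a b) <= (2 * n).+1)%N.
Proof.
have szX (k : nat) (t : R) : (k <= 2 * n -> size (t *: 'X^k) <= (2 * n).+1)%N.
  by move=> kn; apply: leq_trans (size_scale_leq _ _) _; rewrite size_polyXn.
apply: leq_trans (size_polyD _ _) _; rewrite geq_max szX /=; last by lia.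
rewrite big_seq; apply: (big_ind (fun p : {poly R} => (size p <= (2 * n).+1)%N)).
- by rewrite size_poly0.
- by move=> p p' hp hp'; rewrite (leq_trans (size_polyD _ _)) // geq_max hp.
- move=> l; rewrite mem_index_iota => hl.
  by rewrite (leq_trans (size_polyD _ _)) // geq_max !szX //; lia.
Qed.

Lemma exp_polyE (R : realType) (n : nat) (a b : nat -> R) (x : R) :
  exp_poly n a b x =
  expR (- (n%:R * x)) * (exp_poly_numerator n a b).[expR x].
Proof.
rewrite /exp_poly /exp_poly_numerator !hornerE horner_sum mulrDr; congr (_ + _).
  rewrite -expRM_natl mulrCA -expRD addNr expR0 mulr1 //.
rewrite big_distrr /= !big_seq; apply: eq_bigr => l.
rewrite mem_index_iota => /andP[_ ln].
rewrite !hornerE -!expRM_natl natrD natrB; last by lia.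
rewrite mulrDr !(mulrCA (expR (- _))) -!expRD /cosh /sinh.
rewrite (_ : - (n%:R * x) + (n%:R + l%:R) * x = l%:R * x); last by ring.
rewrite (_ : - (n%:R * x) + (n%:R - l%:R) * x = - (l%:R * x)); last by ring.
by rewrite /=; field.
Qed.

Lemma derive1n_expRN_horner (R : realType) (n l : nat) (p : {poly R}) :
  (fun x : R => expR (- (n%:R * x)) * p.[expR x])^`(l)%classic =
  (fun x => expR (- (n%:R * x)) * (iter l (shifted_euler n) p).[expR x]).
Proof.
elim: l => [|l IH]; first by rewrite derive1n0.
rewrite derive1nS IH /=; set g := iter l _ p; apply/funext => x.
have h1 : is_derive x 1 (fun y : R => expR (- (n%:R * y)))
    (expR (- (n%:R * x)) * - n%:R).
  apply: is_derive1_comp (is_derive_expR _) _.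
  have := is_deriveN (is_deriveZ (n%:R : R) (is_derive_id x (1 : R))).
  by rewrite [_ *: _]mulr1.
have h2 := is_derive1_comp (is_derive_poly g _) (is_derive_expR x).
have h3 := is_deriveM h1 h2.
rewrite derive1E (@derive_val _ _ _ _ _ _ _ h3).
rewrite /shifted_euler !hornerE /= /GRing.scale /=; ring.
Qed.
(** Powers of distinct linear factors are pairwise coprime. *)
Lemma prod_XsubC_exp_dvdp (F : fieldType) (I : finType) (z : I -> F)
    (k : I -> nat) (p : {poly F}) : injective z ->
  (forall i, ('X - (z i)%:P) ^+ k i %| p) ->
  \prod_i ('X - (z i)%:P) ^+ k i %| p.
Proof.
move=> z_inj zp; rewrite -big_enum /=; elim: (enum I) (enum_uniq I) => [|i s IH].
  by rewrite big_nil dvd1p.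
case/andP=> iNs us; rewrite big_cons Gauss_dvdp ?zp ?IH //.
rewrite big_seq; elim/big_ind: _ => [|q q' cq cq'|j js].
- by rewrite coprimep1.
- by rewrite coprimepMr cq.
- apply/coprimep_expl/coprimep_expr/coprimep_XsubC2; rewrite subr_eq0.
  by apply: contraNneq iNs => /z_inj <-.
Qed.

(** The factors in [x] and in [y] are kept apart: in a product over the roots the former collect
    into [expR (n%:R * x)], the latter into a constant. *)
Lemma expRB_sinh (R : realType) (x y : R) :
  expR x - expR y = expR (x / 2) * (2 * expR (y / 2)) * sinh ((x - y) / 2).
Proof.
rewrite /sinh (mulrBl _ x) opprB !expRD -!mulNr.
have dbl (t : R) : expR t = expR (t / 2) * expR (t / 2).
  by rewrite -expRD -splitr.
have inv (t : R) : expR (t / 2) * expR (- t / 2) = 1.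
  by rewrite -expRD mulNr subrr expR0.
rewrite (dbl x) (dbl y).
transitivity (expR (x / 2) * expR (x / 2) * (expR (y / 2) * expR (- y / 2))
  - expR (y / 2) * expR (y / 2) * (expR (x / 2) * expR (- x / 2))).
  by rewrite !inv !mulr1.
by field.
Qed.

(** The product of the root factors divides [p] and already has degree [2 * n], the largest degree
    [p] can have; the quotient is therefore a constant. *)
Lemma exp_poly_prod_sinh (R : realType) (n : nat) (a b : nat -> R) (m : nat)
    (r : 'I_m -> R) (alpha : 'I_m -> nat) : (0 < m)%N -> injective r ->
  (forall i, root_of_multiplicity (exp_poly n a b) (r i) (alpha i)) ->
  (\sum_(i < m) alpha i)%N = (2 * n)%N ->
  exists2 K : R, K != 0 & exp_poly n a b =
    fun x => K * \prod_(j < m) sinh ((x - r j) / 2) ^+ alpha j.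
Proof.
move=> m0 r_inj r_root alphaE; set p := exp_poly_numerator n a b.
have EE : exp_poly n a b = fun x => expR (- (n%:R * x)) * p.[expR x].
  by apply/funext => x; exact: exp_polyE.
have expR_inj' : injective (fun i => expR (r i)).
  by move=> i j /expR_inj /r_inj.
have dvd : \prod_i ('X - (expR (r i))%:P) ^+ alpha i %| p.
  apply: prod_XsubC_exp_dvdp => // i.
  apply: (@dvdp_XsubC_exp_shifted_euler _ n); first by rewrite gt_eqF ?expR_gt0.
  move=> l lk; have [_ /(_ l lk) + _] := r_root i.
  rewrite EE derive1n_expRN_horner => /eqP.
  by rewrite mulf_eq0 gt_eqF ?expR_gt0 //= => /eqP.
(* If [p] vanished, so would every derivative, against the nonzero derivative of order [alpha] at a
   root; [0 < m] supplies that root. *)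
have p0 : p != 0.
  have [_ _] := r_root (Ordinal m0); rewrite EE derive1n_expRN_horner => h.
  apply/eqP => pE; apply: h; rewrite pE.
  have -> : iter (alpha (Ordinal m0)) (shifted_euler n) (0 : {poly R}) = 0.
    elim: (alpha _) => //= l ->.
    by rewrite /shifted_euler deriv0 mulr0 scaler0 subr0.
  by rewrite horner0 mulr0.
have szprod : size (\prod_i ('X - (expR (r i))%:P) ^+ alpha i) = (2 * n).+1.
  rewrite size_prod; last by move=> i _; rewrite expf_neq0 // polyXsubC_eq0.
  under eq_bigr do rewrite size_exp_XsubC.
  rewrite -alphaE cardT size_enum_ord.
  have -> : (\sum_(i < m) (alpha i).+1 = \sum_(i < m) alpha i + m)%N.
    under eq_bigr do rewrite -addn1.
    by rewrite big_split /= sum1_card card_ord.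
  lia.
have szp : size p = (2 * n).+1.
  apply/eqP; rewrite eqn_leq size_exp_poly_numerator -szprod.
  exact: dvdp_leq.
have : \prod_i ('X - (expR (r i))%:P) ^+ alpha i %= p.
  by rewrite -dvdp_size_eqp // szp szprod.
(* [C] is the quotient of the two leading coefficients. *)
rewrite eqp_sym => /eqpfP; set C := _ / _ => pE.
have C0 : C != 0 by apply: contraNneq p0 => C0; rewrite pE C0 scale0r.
exists (C * \prod_j (2 * expR (r j / 2)) ^+ alpha j).
  rewrite mulf_neq0 //; apply/prodf_neq0 => j _.
  by rewrite expf_neq0 // mulf_neq0 ?pnatr_eq0 // gt_eqF ?expR_gt0.
rewrite EE; apply/funext => x; rewrite pE hornerZ horner_prod.
have -> : \prod_j (('X - (expR (r j))%:P) ^+ alpha j).[expR x] =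
    expR (n%:R * x) * \prod_j (2 * expR (r j / 2)) ^+ alpha j *
    \prod_j sinh ((x - r j) / 2) ^+ alpha j.
  have -> : expR (n%:R * x) = \prod_(j < m) expR (x / 2) ^+ alpha j.
    by rewrite prodrXr alphaE -expRM_natl natrM; congr expR; field.
  rewrite -!big_split /=; apply: eq_bigr => j _.
  by rewrite horner_exp hornerXsubC expRB_sinh !exprMn.
have e1 : expR (- (n%:R * x)) * expR (n%:R * x) = 1.
  by rewrite -expRD addNr expR0.
by rewrite -[RHS]mul1r -[X in _ = X * _]e1; ring.
Qed.

(** * Logarithmic derivatives of products of hyperbolic sines *)

Definition coth (R : realType) (x : R) : R := cosh x / sinh x.

(** Product rule along the index list. The predicate [P] lets the same formula serve [E_n] (all
    indices) and [Qfun] (all but [i]). *)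
Lemma is_derive_prod_sinh (R : realType) (I : finType) (P : pred I)
    (alpha : I -> nat) (y : I -> R) (x : R) :
  (forall j, P j -> x != y j) ->
  is_derive x 1 (fun t => \prod_(j | P j) sinh ((t - y j) / 2) ^+ alpha j)
    (\prod_(j | P j) sinh ((x - y j) / 2) ^+ alpha j *
     \sum_(j | P j) (alpha j)%:R / 2 * coth ((x - y j) / 2)).
Proof.
move=> xy; elim: (index_enum I) => [|j s IH].
  rewrite !big_nil mulr0.
  have -> : (fun t => \prod_(j <- [::] | P j) sinh ((t - y j) / 2) ^+ alpha j) =
    cst (1 : R) by apply/funext => t; rewrite big_nil.
  exact: is_derive_cst.
case Pj: (P j); last first.
  rewrite !big_cons Pj; move: IH; congr is_derive.
  by apply/funext => t; rewrite big_cons Pj.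
have h1 : is_derive x 1 (fun t => (t - y j) / 2) (2^-1).
  have := is_deriveM (is_deriveB (is_derive_id x (1 : R)) (is_derive_cst (y j) x 1))
    (is_derive_cst (2^-1 : R) x 1).
  by rewrite scaler0 add0r subr0 [_ *: _]mulr1.
have h2 := is_derive1_comp (is_derive_sinh _) h1.
have h3 := is_deriveM (is_deriveX (alpha j) h2) IH.
have -> : (fun t => \prod_(j <- j :: s | P j) sinh ((t - y j) / 2) ^+ alpha j) =
    (@sinh R \o (fun t => (t - y j) / 2)) ^+ alpha j *
    (fun t => \prod_(j <- s | P j) sinh ((t - y j) / 2) ^+ alpha j).
  by apply/funext => t; rewrite big_cons Pj /= fctE exprfctE.
apply: (is_derive_eq h3); rewrite !big_cons Pj exprfctE /= /coth.
have s0 : sinh ((x - y j) / 2) != 0.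
  by rewrite sinh_eq0 mulf_neq0 ?invr_eq0 ?pnatr_eq0 // subr_eq0 xy.
rewrite /GRing.scale /=.
(* The power rule involves the predecessor of the exponent, hence the separate case of exponent
   zero. *)
case: (alpha j) => [|k] /=; last by rewrite exprS; field.
by rewrite expr0; field.
Qed.

Lemma cothB (R : realType) (u v : R) : u != 0 -> v != 0 ->
  coth u - coth v = sinh (v - u) / (sinh u * sinh v).
Proof.
rewrite -sinh_eq0 -(sinh_eq0 v) => u0 v0; rewrite sinhB /coth; field.
by rewrite u0 v0.
Qed.

(** * Error estimate for a single step *)

(** Put [w = delta ^+ 2 / c ^+ 2 <= 1], so the target is [delta * w]. The new error is
    [(e - 2 * t + e * (t * B)) / (1 + t * B)]. Its numerator is at most [delta ^+ 3 / 2 + (delta * w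
    - delta ^+ 3) / 4 <= delta * w / 2], and its denominator is at least [3 / 4]. *)
Lemma newton_error_bound (R : realFieldType) (c delta e t B : R) :
  0 < c -> c < 1 -> delta <= c -> `|e| <= delta ->
  `|t| <= `|e| / 2 -> `|e - 2 * t| <= `|e| ^+ 3 / 2 ->
  `|B| <= delta * (1 - c ^+ 2) / (2 * c ^+ 2) ->
  `|e - 2 * t / (1 + t * B)| <= delta ^+ 3 / c ^+ 2.
Proof.
move=> c0 c1 dc ed te et Bb.
have e0 : 0 <= `|e| by []. have t0 : 0 <= `|t| by []. have B0 : 0 <= `|B| by [].
have d0 : 0 <= delta by lra.
have c20 : 0 < c ^+ 2 by exact: exprn_gt0.
set w := delta ^+ 2 / c ^+ 2.
have w0 : 0 <= w by rewrite divr_ge0 ?sqr_ge0.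
have w1 : w <= 1.
  by rewrite ler_pdivrMr // mul1r ler_sqr ?nnegrE // ltW.
have eB : `|e| * `|B| <= (w - delta ^+ 2) / 2.
  apply: (@le_trans _ _ (delta * (delta * (1 - c ^+ 2) / (2 * c ^+ 2)))).
    exact: ler_pM.
  by rewrite le_eqVlt; apply/orP; left; apply/eqP; rewrite /w; field; lra.
have tB : `|t * B| <= 1 / 4.
  rewrite normrM; have : `|t| * `|B| <= `|e| / 2 * `|B| by exact: ler_wpM2r.
  have := sqr_ge0 delta; lra.
have den : 3 / 4 <= 1 + t * B by move: tB; rewrite ler_norml; lra.
have -> : e - 2 * t / (1 + t * B) = (e - 2 * t + e * (t * B)) / (1 + t * B).
  by field; lra.
rewrite normf_div [`|1 + _|]ger0_norm; last by lra.
rewrite ler_pdivrMr; last by lra.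
have -> : delta ^+ 3 / c ^+ 2 = delta * w by rewrite /w; field; lra.
apply: le_trans (ler_normD _ _) _.
have e3 : `|e| ^+ 3 <= delta ^+ 3 by apply: lerXn2r; rewrite ?nnegrE.
have etB : `|e * (t * B)| <= delta * ((w - delta ^+ 2) / 4).
  rewrite normrM; apply: ler_pM => //.
  rewrite normrM; have : `|t| * `|B| <= `|e| / 2 * `|B| by exact: ler_wpM2r.
  lra.
have dw : 0 <= delta * w by exact: mulr_ge0.
have d3w : delta ^+ 3 <= delta * w.
  rewrite exprS ler_wpM2l // /w ler_pdivlMr //.
  by rewrite ler_piMr ?sqr_ge0 // expr_le1 // ltW.
have h : delta * w * (3 / 4) <= delta * w * (1 + t * B) by rewrite ler_wpM2l.
apply: le_trans h; move: etB.
have -> : delta * ((w - delta ^+ 2) / 4) = (delta * w - delta ^+ 3) / 4 by field.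
lra.
Qed.

(** At most two errors of size [delta] reduce the separation [2 * s + 2 * delta], so both
    half-differences have modulus at least [s]. The numerator is at most [delta] by
    [sinh z <= 2 * z], valid for [z <= 1 / 2], whence [delta <= 1]. *)
Lemma sinh_correction_bound (R : realType) (m : nat) (r y : 'I_m -> R)
    (alpha : 'I_m -> nat) (delta s : R) (i : 'I_m) :
  0 < s -> 0 <= delta <= 1 ->
  (forall j, j != i -> 2 * s + 2 * delta <= `|r i - r j|) ->
  (forall j, `|y j - r j| <= delta) ->
  `|\sum_(j < m | j != i) (alpha j)%:R *
     (coth ((y i - r j) / 2) - coth ((y i - y j) / 2))| <=
  (\sum_(j < m | j != i) (alpha j)%:R) * (delta / sinh s ^+ 2).
Proof.
move=> s0 /andP[d0 d1] rij yr.
have S0 := sinh_gt0 s0.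
apply: le_trans (ler_norm_sum _ _ _) _.
rewrite mulr_suml; apply: ler_sum => j ji.
rewrite normrM ger0_norm ?ler0n // ler_wpM2l ?ler0n //.
have norm_half (t : R) : `|t / 2| = `|t| / 2.
  by rewrite normf_div (@ger0_norm _ 2).
have us : s <= `|(y i - r j) / 2|.
  rewrite norm_half; have := ler_normB (y i - r j) (y i - r i).
  have -> : y i - r j - (y i - r i) = r i - r j by ring.
  by have := rij _ ji; have := yr i; lra.
have vs : s <= `|(y i - y j) / 2|.
  rewrite norm_half.
  have := ler_normB (y i - y j) ((y i - r i) - (y j - r j)).
  have := ler_normB (y i - r i) (y j - r j).
  have -> : y i - y j - (y i - r i - (y j - r j)) = r i - r j by ring.
  by have := rij _ ji; have := yr i; have := yr j; lra.
have u0 : (y i - r j) / 2 != 0 by rewrite -normr_gt0; lra.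
have v0 : (y i - y j) / 2 != 0 by rewrite -normr_gt0; lra.
rewrite cothB //.
have -> : (y i - y j) / 2 - (y i - r j) / 2 = - ((y j - r j) / 2) by field.
rewrite sinhN mulNr normrN normf_div (normrM (sinh _)) !normr_sinh norm_half.
have num : sinh (`|y j - r j| / 2) <= delta.
  apply: le_trans (sinh_le2 _) _; have := yr j; have := normr_ge0 (y j - r j); lra.
have num0 : 0 <= sinh (`|y j - r j| / 2) by apply: le_trans (sinh_ge_id _).
have den : sinh s ^+ 2 <= sinh `|(y i - r j) / 2| * sinh `|(y i - y j) / 2|.
  by rewrite expr2 ler_pM ?ler_sinh // ltW.
have S20 : 0 < sinh s ^+ 2 by exact: exprn_gt0.
apply: ler_pM => //; first by rewrite invr_ge0; lra.
by rewrite lef_pV2 // posrE; lra.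
Qed.

Lemma sinh_newton_step_bound (R : realType) (m n : nat) (r y : 'I_m -> R)
    (alpha : 'I_m -> nat) (K c d delta S : R) (E : R -> R) (i : 'I_m) :
  (0 < alpha i)%N -> (\sum_(j < m) alpha j)%N = (2 * n)%N -> K != 0 ->
  E = (fun x => K * \prod_(j < m) sinh ((x - r j) / 2) ^+ alpha j) ->
  (forall j, j != i -> d <= `|r i - r j|) ->
  0 < c -> 0 < d - 2 * c -> S = sinh ((d - 2 * c) / 2) ->
  c ^+ 2 * (4 * n%:R + (S ^+ 2 - 2) * (alpha i)%:R) < S ^+ 2 * (alpha i)%:R ->
  0 <= delta <= c -> (forall j, `|y j - r j| <= delta) ->
  `|y i - (alpha i)%:R * E (y i) *
      (E^`()%classic (y i) - E (y i) *
        ((Qfun alpha y i)^`()%classic (y i) / Qfun alpha y i (y i)))^-1 - r i|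
    <= delta ^+ 3 / c ^+ 2.
Proof.
move=> ai aE K0 EE rij c0 dc SE cond /andP[d0 dlec] yr.
have ai0 : 0 < (alpha i)%:R :> R by rewrite ltr0n.
have S0 : 0 < S by rewrite SE sinh_gt0 // divr_gt0.
have S20 : 0 < S ^+ 2 by exact: exprn_gt0.
have c20 : 0 < c ^+ 2 by exact: exprn_gt0.
have alphaE : (alpha i)%:R + \sum_(j < m | j != i) (alpha j)%:R = 2 * n%:R :> R.
  by rewrite -natrM -aE [in RHS](bigD1 i) //= natrD natr_sum.
set M := \sum_(j < m | j != i) _ in alphaE.
have M0 : 0 <= M by apply: sumr_ge0.
(* Substituting [4 * n = 2 * (alpha i + M)] cancels the [- 2] in the hypothesis on [c]. The left
   side being nonnegative, [c < 1] follows. *)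
have cond' : 2 * c ^+ 2 * M < S ^+ 2 * (alpha i)%:R * (1 - c ^+ 2).
  have nE : n%:R = ((alpha i)%:R + M) / 2 :> R by rewrite alphaE; field.
  by move: cond; rewrite nE; lra.
have c1 : c < 1.
  have : 0 < S ^+ 2 * (alpha i)%:R * (1 - c ^+ 2).
    by apply: le_lt_trans cond'; rewrite mulr_ge0 // mulr_ge0 // ltW.
  rewrite pmulr_rgt0 ?mulr_gt0 // subr_gt0 => h.
  by rewrite -(@ltr_pXn2r _ 2) ?nnegrE ?expr1n // ltW.
(* At an exact root [E] vanishes and the iteration stays put; elsewhere the logarithmic derivatives
   are available. *)
have [yi|yi] := eqVneq (y i) (r i).
  have -> : E (y i) = 0.
    rewrite EE (bigD1 i) //= yi subrr mul0r sinh0 expr0n.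
    by rewrite (gtn_eqF ai) mul0r mulr0.
  by rewrite mulr0 mul0r subr0 yi subrr normr0 divr_ge0 ?exprn_ge0 // ltW.
have y_neq_r j : y i != r j.
  have [->//|ji] := eqVneq j i.
  apply/negP => /eqP yij; have := rij _ ji; have := yr i.
  by rewrite yij distrC; lra.
have y_neq_y j : j != i -> y i != y j.
  move=> ji; apply/negP => /eqP yij; have := rij _ ji; have := yr i.
  have := yr j; rewrite -yij.
  have := ler_normB (y i - r j) (y i - r i).
  have -> : y i - r j - (y i - r i) = r i - r j by ring.
  by lra.
have sneq0 (t : R) : t != 0 -> sinh (t / 2) != 0.
  by move=> t0; rewrite sinh_eq0 mulf_neq0 // invr_eq0 pnatr_eq0.
have Ey0 : E (y i) != 0.
  rewrite EE mulf_neq0 //; apply/prodf_neq0 => j _.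
  by rewrite expf_neq0 // sneq0 // subr_eq0.
have Qy0 : Qfun alpha y i (y i) != 0.
  apply/prodf_neq0 => j ji; rewrite expf_neq0 // sneq0 // subr_eq0.
  exact: y_neq_y.
have dE : E^`()%classic (y i) =
    E (y i) * \sum_(j < m) (alpha j)%:R / 2 * coth ((y i - r j) / 2).
  have h := is_deriveM (is_derive_cst K (y i) (1 : R))
    (@is_derive_prod_sinh R _ xpredT alpha r (y i) (fun j _ => y_neq_r j)).
  by rewrite EE derive1E (@derive_val _ _ _ _ _ _ _ h) scaler0 addr0 -mulrA.
have dQ : (Qfun alpha y i)^`()%classic (y i) = Qfun alpha y i (y i) *
    \sum_(j < m | j != i) (alpha j)%:R / 2 * coth ((y i - y j) / 2).
  have h := is_derive_prod_sinh alpha y_neq_y.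
  by rewrite derive1E (@derive_val _ _ _ _ _ _ _ h).
set e := y i - r i.
set D := \sum_(j < m | j != i) (alpha j)%:R *
  (coth ((y i - r j) / 2) - coth ((y i - y j) / 2)).
set B := D / (alpha i)%:R.
set t := sinh (e / 2) / cosh (e / 2).
(* The [i]-th term of the logarithmic derivative of [E] gives [t^-1]; the others, less those of
   [Qfun], give [B]. *)
have corr : E^`()%classic (y i) - E (y i) *
    ((Qfun alpha y i)^`()%classic (y i) / Qfun alpha y i (y i)) =
    E (y i) * ((alpha i)%:R / 2 * (t^-1 + B)).
  rewrite dE dQ [Qfun _ _ _ _ * _]mulrC mulfK // -mulrBr; congr (_ * _).
  rewrite (bigD1 i) //= -addrA mulrDr; congr (_ + _).
    by rewrite /t invf_div.
  have -> : (alpha i)%:R / 2 * B = D / 2 by rewrite /B; field; rewrite gt_eqF.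
  by rewrite -[LHS]sumrB /D mulr_suml; apply: eq_bigr => j _; field.
have st : t != 0.
  rewrite /t mulf_neq0 ?sneq0 ?subr_eq0 // invr_eq0.
  by have := cosh_ge1 (e / 2); lra.
have -> : y i - (alpha i)%:R * E (y i) * (E^`()%classic (y i) - E (y i) *
    ((Qfun alpha y i)^`()%classic (y i) / Qfun alpha y i (y i)))^-1 - r i =
    e - 2 * t / (1 + t * B).
  (* No condition on [1 + s * v] is required: if it is zero, both sides are zero because the inverse
     of zero is zero. *)
  have quot (al w s v : R) : al != 0 -> w != 0 -> s != 0 ->
      al * w * (w * (al / 2 * (s^-1 + v)))^-1 = 2 * s / (1 + s * v).
    move=> al0 w0 s0; have -> : s^-1 + v = (1 + s * v) / s by field.
    by rewrite !invfM invrK; set u := (1 + s * v)^-1; field; rewrite s0 al0.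
  by rewrite corr quot // ?(gt_eqF ai0) // /e addrAC.
have e1 : `|e| <= 1 by have := yr i; rewrite -/e; lra.
have norm_half (x : R) : `|x / 2| = `|x| / 2.
  by rewrite normf_div (@ger0_norm _ 2).
apply: newton_error_bound => //.
- exact: yr.
- by rewrite -norm_half; exact: normr_tanh_le.
- have -> : e - 2 * t = 2 * (e / 2 - t) by field.
  rewrite normrM (@ger0_norm _ 2) //.
  have := @sub_tanh_le R (e / 2); rewrite norm_half -/t => /(_ _) h.
  have : `|e / 2 - t| <= 2 * (`|e| / 2) ^+ 3 by apply: h; lra.
  by rewrite expr_div_n; lra.
- rewrite /B normf_div [`|(alpha i)%:R|]ger0_norm ?ler0n // ler_pdivrMr //.
  have := @sinh_correction_bound R m r y alpha delta ((d - 2 * c) / 2) i.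
  rewrite -SE -/D -/M => h.
  apply: (@le_trans _ _ (M * (delta / S ^+ 2))).
    apply: h => //; first by rewrite divr_gt0.
      by apply/andP; lra.
    by move=> j ji; have := rij _ ji; lra.
  (* Extracting the common factor [delta / (2 * c ^+ 2 * S ^+ 2)] from both sides leaves exactly
     [cond']. *)
  have -> : M * (delta / S ^+ 2) =
      delta / (2 * c ^+ 2 * S ^+ 2) * (2 * c ^+ 2 * M).
    by field; rewrite !gt_eqF.
  have -> : delta * (1 - c ^+ 2) / (2 * c ^+ 2) * (alpha i)%:R =
      delta / (2 * c ^+ 2 * S ^+ 2) *
      (S ^+ 2 * (alpha i)%:R * (1 - c ^+ 2)).
    by field; rewrite !gt_eqF.
  by rewrite ler_wpM2l ?(ltW cond') // divr_ge0 // !mulr_ge0 // ltW.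
Qed.

(** * Cubic convergence by induction on the iteration number *)

Theorem theorem3 (R : realType) (n : nat) (a b : nat -> R)
    (hlead : a n <> 0 \/ b n <> 0)
    (m : nat) (hm : (2 <= m)%N)
    (r : 'I_m -> R) (hr : injective r)
    (alpha : 'I_m -> nat)
    (hroot : forall i : 'I_m,
       root_of_multiplicity (exp_poly n a b) (r i) (alpha i))
    (hsum : (\sum_(i < m) alpha i)%N = (2 * n)%N)
    (d : R) (hd : is_min_dist r d)
    (q c : R) (hq1 : q < 1) (hq0 : 0 < q) (hc : 0 < c) (hdc : 0 < d - 2 * c)
    (S : R) (hS : S = sinh ((d - 2 * c) / 2))
    (hcond : forall i : 'I_m,
       c ^+ 2 * (4 * n%:R + (S ^+ 2 - 2) * (alpha i)%:R)
         < S ^+ 2 * (alpha i)%:R)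
    (x : nat -> 'I_m -> R)
    (hx : forall (k : nat) (i : 'I_m),
       x k.+1 i =
         x k i - (alpha i)%:R * exp_poly n a b (x k i) *
           ((exp_poly n a b)^`()%classic (x k i) -
            exp_poly n a b (x k i) *
              ((Qfun alpha (x k) i)^`()%classic (x k i) /
               Qfun alpha (x k) i (x k i)))^-1)
    (hinit : forall i : 'I_m, `|x 0%N i - r i| <= c * q) :
  forall (k : nat) (i : 'I_m), `|x k i - r i| <= c * q ^+ (3 ^ k)%N.
Proof.
have [K K0 EE] := exp_poly_prod_sinh (ltnW hm) hr hroot hsum.
elim=> [|k IH] i; first by rewrite expn0 expr1.
(* The induction bound is itself an admissible [delta] for the single-step estimate. *)
have qk : 0 <= c * q ^+ (3 ^ k) <= c.
  apply/andP; split; first by rewrite mulr_ge0 ?exprn_ge0 ?ltW.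
  by rewrite ler_piMr ?(ltW hc) // exprn_ile1 // ltW.
have -> : c * q ^+ (3 ^ k.+1) = (c * q ^+ (3 ^ k)) ^+ 3 / c ^+ 2.
  by rewrite expnSr exprM; field; rewrite gt_eqF.
rewrite hx; apply: (sinh_newton_step_bound (n := n) (d := d) (S := S)
  _ hsum K0 EE _ hc hdc hS (hcond i) qk IH).
- by case: (hroot i).
- move=> j ji; apply: hd.2 => ij; by rewrite ij eqxx in ji.
Qed.
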